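(* Let $\mathrm L$ be a coatomic logic. (a) If $\mathrm L$ has a finite antitheorem and a unary global DDT w.r.t. a finite set $p\Rightarrow q$, then $\alpha_{\mathrm{Th}}(\mathrm L)$ is precisely the extension of $\mathrm L$ by the DDT-axiomatic form of the LEM. (b) If $\mathrm L$ has a unary global IL w.r.t. a finite set ${\sim}p$ and a binary global PCP w.r.t. a set $\sqcup(p,q)$, then $\alpha_{\mathrm{Th}}(\mathrm L)$ is precisely the extension of $\mathrm L$ by the PCP-axiomatic form of the LEM.
   Context: A logic $\mathrm{L}$ is given by an infinite set of variables, the absolutely free algebra of formulas $\mathbf{Fm}\,\mathrm L$ over it in some signature (with underlying set $\mathrm{Fm}\,\mathrm{L}$), and a relation $\Gamma \vdash_{\mathrm{L}} \varphi$ between sets of formulas and formulas which is reflexive, monotone, closed under cut (if $\Gamma \vdash_{\mathrm L} \varphi$ for all $\varphi\in\Phi$ and $\Phi \vdash_{\mathrm L} \psi$, then $\Gamma \vdash_{\mathrm L} \psi$) and structural (closed under substitutions). $\Gamma\vdash_{\mathrm L}\Phi$ means $\Gamma\vdash_{\mathrm L}\varphi$ for all $\varphi\in\Phi$. A theory is a set of formulas closed under $\vdash_{\mathrm L}$; it is simple if it is maximal among theories different from $\mathrm{Fm}\,\mathrm L$. $\mathrm L$ is coatomic if every theory different from $\mathrm{Fm}\,\mathrm L$ is included in a simple theory. The extension of $\mathrm L$ by a set of axioms is the least logic (over the same formulas) that extends $\vdash_{\mathrm L}$ and derives these formulas from $\emptyset$. The semisimple companion $\alpha_{\mathrm{Th}}(\mathrm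 L)$ is the logic determined by the matrices $\langle\mathbf{Fm}\,\mathrm L,T\rangle$ with $T$ a simple theory of $\mathrm L$: $\Gamma\vdash_{\alpha_{\mathrm{Th}}(\mathrm L)}\varphi$ iff for every simple theory $T$ of $\mathrm L$ and every substitution $\sigma$, $\sigma[\Gamma]\subseteq T$ implies $\sigma(\varphi)\in T$. An antitheorem of $\mathrm L$ is a set of formulas $\Gamma$ such that no homomorphism $h$ from $\mathbf{Fm}\,\mathrm L$ to an algebra $\mathbf A$ satisfies $h[\Gamma]\subseteq F$ for a non-trivial model $\langle\mathbf A,F\rangle$ of $\mathrm L$ (i.e. $F\subsetneq A$ and $g^{-1}[F]$ is a theory of $\mathrm L$ for each homomorphism $g\colon\mathbf{Fm}\,\mathrm L\to\mathbf A$); equivalently, $\sigma[\Gamma]\vdash_{\mathrm L}\mathrm{Fm}\,\mathrm L$ for each substitution $\sigma$. Unary global DDT w.r.t. a set of formulas $p\Rightarrow q$ in two variables: $\Gamma,\varphi\vdash_{\mathrm L}\psi$ iff $\Gamma\vdash_{\mathrm L}\varphi\Rightarrow\psi$, for all $\Gamma,\varphi,\psi$ (where $\varphi\Rightarrow\psi$ is the set obtained by substitution). Unary global IL w.r.t. a set of formulas ${\sim}p$ in one variable: $\Gamma,\varphi\vdash_{\mathrm L}\mathrm{Fm}\,\mathrm L$ iff $\Gamma\vdash_{\mathrm L}{\sim}\varphi$, for all $\Gamma,\varphi$. Binary global PCP (proof by cases property) w.r.t. a set of formulas $\sqcup(p,q)$ in two variables: ($\Gamma,\varphi\vdash_{\mathrm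 L}\chi$ and $\Gamma,\psi\vdash_{\mathrm L}\chi$) iff $\Gamma,\sqcup(\varphi,\psi)\vdash_{\mathrm L}\chi$, for all $\Gamma,\varphi,\psi,\chi$. DDT-axiomatic form of the LEM (case (a)): let $\boldsymbol{\bot}$ be a finite antitheorem and put ${\sim}\varphi:=\bigcup_{\pi\in\boldsymbol{\bot}}(\varphi\Rightarrow\pi)$. For a finite tuple of formulas define $\emptyset\Rightarrow\psi:=\{\psi\}$ and $\langle\overline\varphi,\varphi_{n+1}\rangle\Rightarrow\psi:=\bigcup\{\varphi_{n+1}\Rightarrow\chi\mid\chi\in\overline\varphi\Rightarrow\psi\}$; a finite set on the left of $\Rightarrow$ is treated as a finite tuple enumerating it, and for a set $X$ on the right, $\overline\varphi\Rightarrow X:=\bigcup_{\chi\in X}(\overline\varphi\Rightarrow\chi)$. The DDT-axiomatic form of the LEM is the set of formulas $(p\Rightarrow q)\Rightarrow(({\sim}p\Rightarrow q)\Rightarrow q)$. PCP-axiomatic form of the LEM (case (b)): the set of formulas $\sqcup(p,{\sim}p):=\bigcup_{\nu\in{\sim}p}\sqcup(p,\nu)$. *)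

(* Defs.v *)
From HB Require Import structures.
From mathcomp Require Import all_boot.
From mathcomp Require Import boolp classical_sets functions cardinality.

Set Implicit Arguments.
Unset Strict Implicit.
Unset Printing Implicit Defensive.

Local Open Scope classical_set_scope.

Record signature := Signature { symbol : Type; arity : symbol -> nat }.

Record algebra (Sg : signature) := Algebra {
  carrier :> Type;
  op : forall o : symbol Sg, ('I_(arity o) -> carrier) -> carrier
}.

Record hom (Sg : signature) (A B : algebra Sg) := Hom {
  hom_fun :> A -> B;
  homP : forall (o : symbol Sg) (a : 'I_(arity o) -> A),
    hom_fun (op a) = op (fun i => hom_fun (a i))
}.

(* Formulas over an arbitrary set of variables: V is the set of variables of
   the logic, or 'I_n for formulas in n variables. *)
Inductive fm (Sg : signature) (V : Type) : Type :=
| Var of V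
| App (o : symbol Sg) of ('I_(arity o) -> fm Sg V).
Arguments Var {Sg V} _.
Arguments App {Sg V} o _.

HB.instance Definition _ (Sg : signature) (V : Type) := gen_eqMixin (fm Sg V).
HB.instance Definition _ (Sg : signature) (V : Type) :=
  gen_choiceMixin (fm Sg V).

Definition Fm (Sg : signature) (V : Type) : algebra Sg :=
  Algebra (@App Sg V).

Fixpoint eval (Sg : signature) (V : Type) (A : algebra Sg) (v : V -> A)
    (f : fm Sg V) : A :=
  match f with
  | Var x => v x
  | App o a => op (fun i => eval v (a i))
  end.

Definition substitution (Sg : signature) (V : Type) := hom (Fm Sg V) (Fm Sg V).

Definition inst1 (Sg : signature) (V : Type) (N : set (fm Sg 'I_1))
    (phi : fm Sg V) : set (fm Sg V) :=
  [set @eval Sg 'I_1 (Fm Sg V) (tnth [tuple phi]) d | d in N].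

Definition inst2 (Sg : signature) (V : Type) (D : set (fm Sg 'I_2))
    (phi psi : fm Sg V) : set (fm Sg V) :=
  [set @eval Sg 'I_2 (Fm Sg V) (tnth [tuple phi; psi]) d | d in D].

(* The set of variables is required to be infinite in the theorem, not here. *)
Record logic (Sg : signature) (V : Type) := Logic {
  entails :> set (fm Sg V) -> fm Sg V -> Prop;
  entails_refl : forall (G : set (fm Sg V)) phi, G phi -> entails G phi;
  entails_mono : forall (G H : set (fm Sg V)) phi,
    G `<=` H -> entails G phi -> entails H phi;
  entails_cut : forall (G H : set (fm Sg V)) psi,
    (forall phi, H phi -> entails G phi) -> entails H psi -> entails G psi;
  entails_subst : forall (s : substitution Sg V) (G : set (fm Sg V)) phi,
    entails G phi -> entails (s @` G) (s phi)
}.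

Section Logic.
Variables (Sg : signature) (V : Type) (L : logic Sg V).
Implicit Types (G H T : set (fm Sg V)) (phi psi chi : fm Sg V).

Definition entails_set G H : Prop := forall phi, H phi -> L G phi.

Definition theory T : Prop := forall phi, L T phi -> T phi.

Definition simple_theory T : Prop :=
  [/\ theory T, T <> setT &
      forall T', theory T' -> T' <> setT -> T `<=` T' -> T' = T].

Definition coatomic : Prop :=
  forall T, theory T -> T <> setT -> exists2 T', simple_theory T' & T `<=` T'.

Definition companion_entails G phi : Prop :=
  forall T, simple_theory T -> forall s : substitution Sg V,
    s @` G `<=` T -> T (s phi).

Definition model (A : algebra Sg) (F : set A) : Prop :=
  forall g : hom (Fm Sg V) A, theory (g @^-1` F).

Definition antitheorem G : Prop :=
  forall (A : algebra Sg) (F : set A), model F -> F <> setT ->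
    forall h : hom (Fm Sg V) A, ~ (h @` G `<=` F).

Definition global_DDT (D : set (fm Sg 'I_2)) : Prop :=
  forall G phi psi,
    L (G `|` [set phi]) psi <-> entails_set G (inst2 D phi psi).

Definition global_IL (N : set (fm Sg 'I_1)) : Prop :=
  forall G phi,
    entails_set (G `|` [set phi]) setT <-> entails_set G (inst1 N phi).

Definition global_PCP (C : set (fm Sg 'I_2)) : Prop :=
  forall G phi psi chi,
    L (G `|` [set phi]) chi /\ L (G `|` [set psi]) chi <->
    L (G `|` inst2 C phi psi) chi.

(* E is the least logic extending L in which the formulas of Ax are theorems. *)
Definition is_axiomatic_extension (Ax : set (fm Sg V)) (E : logic Sg V) : Prop :=
  [/\ forall G phi, L G phi -> E G phi,
      forall phi, Ax phi -> E set0 phi &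
      forall E' : logic Sg V,
        (forall G phi, L G phi -> E' G phi) ->
        (forall phi, Ax phi -> E' set0 phi) ->
        forall G phi, E G phi -> E' G phi].

End Logic.

Section Companion.
Variables (Sg : signature) (V : Type) (L : logic Sg V).

Fact companion_refl (G : set (fm Sg V)) phi :
  G phi -> companion_entails L G phi.
Proof. by move=> Gphi T _ s; apply; exists phi. Qed.

Fact companion_mono (G H : set (fm Sg V)) phi :
  G `<=` H -> companion_entails L G phi -> companion_entails L H phi.
Proof.
move=> GH Gphi T simT s sHT; apply: Gphi => // _ [x Gx <-].
by apply: sHT; exists x => //; apply: GH.
Qed.

Fact companion_cut (G H : set (fm Sg V)) psi :
  (forall phi, H phi -> companion_entails L G phi) ->
  companion_entails L H psi -> companion_entails L G psi.
Proof.
move=> GH Hpsi T simT s sGT; apply: Hpsi => // _ [x Hx <-].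
exact: GH.
Qed.

Fact comp_homP (A B C : algebra Sg) (g : hom B C) (f : hom A B)
    (o : symbol Sg) (a : 'I_(arity o) -> A) :
  g (f (op a)) = op (fun i => g (f (a i))).
Proof. by rewrite homP homP. Qed.

Definition comp_hom (A B C : algebra Sg) (g : hom B C) (f : hom A B) :
  hom A C := @Hom Sg A C (fun x => g (f x)) (comp_homP g f).

Fact companion_subst (s : substitution Sg V) (G : set (fm Sg V)) phi :
  companion_entails L G phi -> companion_entails L (s @` G) (s phi).
Proof.
move=> Gphi T simT t tsGT; apply: (Gphi T simT (comp_hom t s)) => _ [x Gx <-].
by apply: tsGT; exists (s x) => //; exists x.
Qed.

Definition semisimple_companion : logic Sg V :=
  Logic companion_refl companion_mono companion_cut companion_subst.

End Companion.

Section LEM.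
Variables (Sg : signature) (V : Type).
Implicit Types (G H : set (fm Sg V)) (phi psi : fm Sg V).

Definition enumeration (enum : set (fm Sg V) -> seq (fm Sg V)) : Prop :=
  forall G, finite_set G -> [set` enum G] = G.

Section DDT.
Variables (enum : set (fm Sg V) -> seq (fm Sg V)) (D : set (fm Sg 'I_2)).

(* foldl consumes the tuple from the left, so that its last component is the
   outermost premise. *)
Definition tuple_imp (s : seq (fm Sg V)) psi : set (fm Sg V) :=
  foldl (fun X phi => \bigcup_(chi in X) inst2 D phi chi) [set psi] s.

Definition set_imp G H : set (fm Sg V) :=
  \bigcup_(chi in H) tuple_imp (enum G) chi.

Definition ddt_neg (bot : set (fm Sg V)) phi : set (fm Sg V) :=
  \bigcup_(pi in bot) inst2 D phi pi.

Definition DDT_LEM (bot : set (fm Sg V)) (p q : V) : set (fm Sg V) :=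
  set_imp (inst2 D (Var p) (Var q))
    (set_imp (set_imp (ddt_neg bot (Var p)) [set Var q]) [set Var q]).

End DDT.

Definition PCP_LEM (N : set (fm Sg 'I_1)) (C : set (fm Sg 'I_2)) (p : V) :
    set (fm Sg V) :=
  \bigcup_(nu in inst1 N (Var p)) inst2 C (Var p) nu.

End LEM.

(* Main.v *)
(* A simple theory T decides every formula phi: either phi is in T, or T together
   with phi is trivial and T proves the negation of phi. This makes the LEM valid
   in the semisimple companion. Conversely, if an extension E validating the LEM
   does not prove phi from G, the LEM shows that the negation of phi can be added
   to the E-theory of G without L-proving phi, and coatomicity then yields a simple
   theory which contains G but, since it contains the negation of phi, omits phi. *)
Require Import Defs.
From mathcomp Require Import all_boot.
From mathcomp Require Import boolp classical_sets functions cardinality.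

Set Implicit Arguments.
Unset Strict Implicit.
Unset Printing Implicit Defensive.

Local Open Scope classical_set_scope.

(** * Evaluation and homomorphisms *)

Lemma hom_eval (Sg : signature) (U : Type) (A B : algebra Sg) (h : hom A B)
    (v : U -> A) (f : fm Sg U) : h (eval v f) = eval (h \o v) f.
Proof.
elim: f => [x //|o a IH] /=.
by rewrite homP; congr op; apply/funext => i; apply: IH.
Qed.

Lemma eval_Var (Sg : signature) (V : Type) (f : fm Sg V) :
  @eval Sg V (Fm Sg V) Var f = f.
Proof. by elim: f => //= o a IH; congr App; apply/funext => i; apply: IH. Qed.

Definition eval_hom (Sg : signature) (V : Type) (A : algebra Sg) (v : V -> A) :
  hom (Fm Sg V) A := @Hom Sg (Fm Sg V) A (eval v) (fun=> fun=> erefl).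

Lemma set_cons (T : eqType) (x : T) (t : seq T) :
  [set` x :: t] = [set` t] `|` [set x].
Proof.
apply/seteqP; split=> y /=; rewrite inE; first by case/predU1P; [right|left].
by case=> [->|->]; rewrite ?eqxx ?orbT.
Qed.

(** * Substitution instances of the defined sets of formulas *)

Section Substitution.
Variables (Sg : signature) (V : Type) (s : substitution Sg V).
Implicit Types (phi psi : fm Sg V).

Lemma image_inst1 (N : set (fm Sg 'I_1)) phi :
  s @` inst1 N phi = inst1 N (s phi).
Proof.
rewrite /inst1 image_comp; apply: eq_imagel => d _ /=.
rewrite hom_eval; congr (@eval _ _ (Fm Sg V) _ _).
by apply/funext => i; rewrite /= !(tnth_nth phi); case: i => [[]].
Qed.

Lemma image_inst2 (D : set (fm Sg 'I_2)) phi psi :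
  s @` inst2 D phi psi = inst2 D (s phi) (s psi).
Proof.
rewrite /inst2 image_comp; apply: eq_imagel => d _ /=.
rewrite hom_eval; congr (@eval _ _ (Fm Sg V) _ _).
by apply/funext => i; rewrite /= !(tnth_nth phi); case: i => [[|[]]].
Qed.

Lemma image_ddt_neg (D : set (fm Sg 'I_2)) bot phi :
  s @` ddt_neg D bot phi = ddt_neg D (s @` bot) (s phi).
Proof.
rewrite /ddt_neg image_bigcup bigcup_image.
by apply: eq_bigcupr => x _; rewrite image_inst2.
Qed.

Lemma image_tuple_imp (D : set (fm Sg 'I_2)) (t : seq (fm Sg V)) psi :
  s @` tuple_imp D t psi = tuple_imp D (map s t) (s psi).
Proof.
rewrite /tuple_imp -[[set s psi]]image_set1; move: [set psi].
elim: t => [//|phi t IH] X /=.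
rewrite IH image_bigcup bigcup_image; congr (foldl _ _ _).
by apply: eq_bigcupr => x _; rewrite image_inst2.
Qed.

Lemma image_PCP_LEM (N : set (fm Sg 'I_1)) (C : set (fm Sg 'I_2)) (p : V) :
  s @` PCP_LEM N C p =
  \bigcup_(nu in inst1 N (s (Var p))) inst2 C (s (Var p)) nu.
Proof.
rewrite /PCP_LEM image_bigcup -image_inst1 (bigcup_image _ s).
by apply: eq_bigcupr => x _; rewrite image_inst2.
Qed.

End Substitution.

(** * Finiteness of the sets of premises, on which [enum] is then faithful *)

Section Finiteness.
Variables (Sg : signature) (V : Type) (D : set (fm Sg 'I_2)).
Hypothesis finD : finite_set D.

Lemma finite_inst2 (phi psi : fm Sg V) : finite_set (inst2 D phi psi).
Proof. exact: finite_image. Qed.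

Lemma finite_ddt_neg (bot : set (fm Sg V)) phi :
  finite_set bot -> finite_set (ddt_neg D bot phi).
Proof. by move=> fb; apply: bigcup_finite => // *; apply: finite_inst2. Qed.

Lemma finite_tuple_imp (t : seq (fm Sg V)) psi : finite_set (tuple_imp D t psi).
Proof.
rewrite /tuple_imp; move: (finite_set1 psi); move: [set psi].
elim: t => [//|phi t IH] X fX /=; apply: IH.
by apply: bigcup_finite => // *; apply: finite_inst2.
Qed.

Lemma finite_set_imp enum (G H : set (fm Sg V)) :
  finite_set H -> finite_set (set_imp enum D G H).
Proof. by move=> fH; apply: bigcup_finite => // *; apply: finite_tuple_imp. Qed.

End Finiteness.

(** * Theories, simple theories and the companion *)

Section Logic.
Variables (Sg : signature) (V : Type) (L : logic Sg V).
Implicit Types (G H T : set (fm Sg V)) (phi psi chi : fm Sg V).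

Lemma entails_setU_cut G H psi :
  entails_set L G H -> L (G `|` H) psi -> L G psi.
Proof. by move=> GH; apply: entails_cut => phi [/entails_refl//|/GH]. Qed.

Lemma theory_entails_set T H : theory L T -> entails_set L T H <-> H `<=` T.
Proof.
by move=> thT; split=> [TH phi /TH /thT//|HT phi /HT /entails_refl].
Qed.

Lemma theory_closure G : theory L (L G).
Proof. by move=> phi; apply: entails_cut. Qed.

Lemma theory_preimage (s : substitution Sg V) T :
  theory L T -> theory L (s @^-1` T).
Proof.
move=> thT phi /(entails_subst s) Lphi; apply: thT.
by apply: entails_mono Lphi; apply: image_preimage_subset.
Qed.

(** By [theory_preimage], T is the filter of a model on the formula algebra, so the antitheorem can
    be tested there with [h := s]. *)
Lemma antitheorem_theory bot (s : substitution Sg V) T :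
  antitheorem L bot -> theory L T -> s @` bot `<=` T -> T = setT.
Proof.
move=> abot thT sbot; apply/not_notP => nT.
by apply: (abot (Fm Sg V) T _ nT s sbot) => g; apply: theory_preimage.
Qed.

(** Otherwise the theory generated by T and [phi] is proper and contains T, so by maximality it
    equals T, which then contains [phi]. *)
Lemma simple_theory_dec T phi :
  simple_theory L T -> T phi \/ entails_set L (T `|` [set phi]) setT.
Proof.
move=> [thT _ maxT]; have [|nT] := pselect (T phi); [by left|right].
apply/not_notP => nE; apply: nT.
rewrite -(maxT _ (@theory_closure (T `|` [set phi]))).
- by apply: entails_refl; right.
- by move=> E; apply: nE => x _; rewrite E.
- by move=> x Tx; apply: entails_refl; left.
Qed.

Lemma companion_extends G phi : L G phi -> semisimple_companion L G phi.
Proof.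
move=> LG T [thT _ _] s sGT; apply: thT.
exact/(entails_mono sGT)/entails_subst.
Qed.

Lemma companion_axioms (Ax : set (fm Sg V)) :
  (forall T (s : substitution Sg V), simple_theory L T -> s @` Ax `<=` T) ->
  forall phi, Ax phi -> semisimple_companion L set0 phi.
Proof. by move=> AxT phi Axphi T sT s _; apply: (AxT T s sT); exists phi. Qed.

Lemma axiom_instances (Ax : set (fm Sg V)) (s : substitution Sg V) T :
  (forall phi, Ax phi -> L set0 phi) -> theory L T -> s @` Ax `<=` T.
Proof.
move=> LAx thT _ [phi /LAx /(entails_subst s) Lphi <-]; apply: thT.
by apply: entails_mono Lphi; rewrite image_set0.
Qed.

Lemma theory_extension (E : logic Sg V) T :
  (forall G phi, L G phi -> E G phi) -> theory E T -> theory L T.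
Proof. by move=> LE thT phi /LE /thT. Qed.

(** Core shared by both forms of the LEM. [N] stands for the negation of [phi]: the first clause
    says that it refutes [phi], the second is what the LEM provides. *)
Lemma companion_least (E : logic Sg V) :
  coatomic L -> (forall G phi, L G phi -> E G phi) ->
  (forall phi, exists N : set (fm Sg V),
    (forall T, theory L T -> N `<=` T -> T phi -> T = setT) /\
    (forall T, theory E T -> L (T `|` N) phi -> T phi)) ->
  forall G phi, semisimple_companion L G phi -> E G phi.
Proof.
move=> coat LE negE G phi cG; have [N [incons lem]] := negE phi.
apply: (lem (E G)); first by move=> x; apply: entails_cut.
apply/not_notP => nphi.
(* If [E G] with [N] does not L-prove [phi], its L-closure is proper and so lies in a simple
   theory. *)
have [|T sT ET] := coat _ (@theory_closure (E G `|` N)).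
  by move=> ET; apply: nphi; rewrite ET.
have [thT nT _] := sT; apply: nT; apply: (incons T thT).
  by move=> x Nx; apply/ET/entails_refl; right.
(* The companion is used at the identity substitution. *)
have := cG T sT (eval_hom (Var : V -> Fm Sg V)).
rewrite /= eval_Var; apply => _ [x Gx <-] /=; rewrite eval_Var.
by apply/ET/entails_refl; left; apply: entails_refl.
Qed.

(** * Consequences of the DDT *)

Section DDT.
Variables (D : set (fm Sg 'I_2)).
Hypothesis ddt : global_DDT L D.

Lemma ddt_refl G phi : entails_set L G (inst2 D phi phi).
Proof. by apply/ddt/entails_refl; right. Qed.

Lemma ddt_detach G phi psi : L G phi -> L (G `|` inst2 D phi psi) psi.
Proof.
move=> Gphi; apply: (@entails_setU_cut _ [set phi]).
  by move=> _ ->; apply: entails_mono Gphi; left.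
by apply/ddt => x Dx; apply: entails_refl; right.
Qed.

(** [bot] is an arbitrary set here, so this also covers one step of the fold in [tuple_imp]. *)
Lemma ddt_neg_entails bot G phi :
  entails_set L G (ddt_neg D bot phi) <-> entails_set L (G `|` [set phi]) bot.
Proof.
split=> [LG pi bpi|LG x [pi bpi]].
  by apply/ddt => x Dx; apply: LG; exists pi.
by move: x; apply/ddt/LG.
Qed.

Lemma tuple_imp_entails G (t : seq (fm Sg V)) psi :
  entails_set L G (tuple_imp D t psi) <-> L (G `|` [set` t]) psi.
Proof.
(* The accumulator of [foldl] changes, so the induction needs an arbitrary set of conclusions. *)
suff imp X : entails_set L G
    (foldl (fun X phi => \bigcup_(chi in X) inst2 D phi chi) X t) <->
    entails_set L (G `|` [set` t]) X.
  rewrite /tuple_imp imp; split=> [|LG _ ->//]; exact.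
elim: t X => [|phi t IH] X /=; first by rewrite set_nil setU0.
rewrite IH set_cons setUA.
exact: (ddt_neg_entails X (G `|` [set` t]) phi).
Qed.

Variable enum : set (fm Sg V) -> seq (fm Sg V).
Hypothesis enumP : enumeration enum.

(** [enum] need not commute with [s], but [map s (enum H)] has the same elements as the image of
    [H], and by [tuple_imp_entails] only the elements of a tuple matter. *)
Lemma set_imp_entails (s : substitution Sg V) G H K : finite_set H ->
  entails_set L G (s @` set_imp enum D H K) <->
  entails_set L (G `|` s @` H) (s @` K).
Proof.
move=> finH.
have mapE : [set` map s (enum H)] = s @` H.
  rewrite -[in RHS](enumP finH); apply/seteqP; split=> x /=.
    by move=> /mapP [y yH ->]; exists y.
  by move=> [y yH <-]; apply: map_f.
have imp psi : entails_set L G (s @` tuple_imp D (enum H) psi) <->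
    L (G `|` s @` H) (s psi).
  by rewrite image_tuple_imp tuple_imp_entails mapE.
rewrite /set_imp; split.
  move=> LG _ [psi Kpsi <-]; apply/imp => _ [x tx <-].
  by apply: LG; exists x => //; exists psi.
move=> LG _ [x [psi Kpsi tx] <-].
have /imp : L (G `|` s @` H) (s psi) by apply: LG; exists psi.
by apply; exists x.
Qed.

(** The DDT resolves the two outer implications; the innermost one, ~p => q, stays intact as a
    premise. *)
Lemma DDT_LEM_entails (s : substitution Sg V) G bot (p q : V) :
  finite_set D -> finite_set bot ->
  entails_set L G (s @` DDT_LEM enum D bot p q) <->
  L (G `|` inst2 D (s (Var p)) (s (Var q))
       `|` s @` set_imp enum D (ddt_neg D bot (Var p)) [set Var q]) (s (Var q)).
Proof.
move=> finD finb; rewrite /DDT_LEM.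
rewrite (set_imp_entails _ _ _ (finite_inst2 finD _ _)) set_imp_entails.
  by rewrite image_set1 image_inst2; split=> [|LG _ ->//]; exact.
exact/finite_set_imp.
Qed.

End DDT.

(** * Consequences of the PCP *)

Lemma PCP_finite_cut (C : set (fm Sg 'I_2)) T H phi :
  global_PCP L C -> finite_set H ->
  (forall nu, H nu -> entails_set L T (inst2 C phi nu)) ->
  L (T `|` H) phi -> L T phi.
Proof.
move=> pcp /finite_seqP [t ->] {H}.
elim: t => [|nu t IH] TC; first by rewrite set_nil setU0.
rewrite set_cons setUA => Lphi.
apply: IH => [x tx|]; first by apply: TC; rewrite /= inE tx orbT.
have TCnu : entails_set L (T `|` [set` t]) (inst2 C phi nu).
  move=> x Cx; apply: (@entails_mono _ _ L T); first by left.
  by apply: (TC nu) => //; rewrite /= inE eqxx.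
apply: (entails_setU_cut TCnu); apply/pcp; split=> //.
by apply: entails_refl; right.
Qed.

(** The disjunction proves each of its own members, so by the PCP either disjunct alone proves
    them. *)
Lemma PCP_intro (C : set (fm Sg 'I_2)) T phi psi :
  global_PCP L C -> L T phi \/ L T psi -> entails_set L T (inst2 C phi psi).
Proof.
move=> pcp disj x Cx.
have [Lphi Lpsi] : L (T `|` [set phi]) x /\ L (T `|` [set psi]) x.
  by apply/pcp/entails_refl; right.
by case: disj => LT; [apply: entails_setU_cut Lphi|apply: entails_setU_cut Lpsi];
  move=> _ ->.
Qed.

End Logic.

(** * The two axiomatizations of the companion *)

Section Companion.
Variables (Sg : signature) (V : Type) (L : logic Sg V).
Hypothesis L_coatomic : coatomic L.

Lemma companion_DDT_LEM (bot : set (fm Sg V)) (D : set (fm Sg 'I_2))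
    (enum : set (fm Sg V) -> seq (fm Sg V)) (p q : V) :
  finite_set bot -> antitheorem L bot -> finite_set D -> global_DDT L D ->
  enumeration enum ->
  is_axiomatic_extension L (DDT_LEM enum D bot p q) (semisimple_companion L).
Proof.
move=> finb abot finD ddt enumP; split; first exact: companion_extends.
  apply: companion_axioms => T s sT; have [thT _ _] := sT.
  apply/(theory_entails_set _ thT)/(DDT_LEM_entails ddt enumP) => //.
  (* If T contains [s p], detach p => q; otherwise T proves ~p, and ~p => q is detached. *)
  have [Tp|triv] := simple_theory_dec (s (Var p)) sT.
    apply: (entails_mono (G := T `|` inst2 D (s (Var p)) (s (Var q)))).
      by left.
    by apply: (ddt_detach ddt); apply: entails_refl.
  set A := s @` set_imp _ _ _ _.
  (* Read through the DDT, the trivial derivation of [A] from itself says that T, [A] and ~p prove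
     q. *)
  have : entails_set L (T `|` A) A by move=> x Ax; apply: entails_refl; right.
  move/(set_imp_entails ddt enumP _ _ _ (finite_ddt_neg finD _ finb)).
  rewrite image_set1 image_ddt_neg => /(_ _ erefl) LA.
  apply: (@entails_mono _ _ L (T `|` A)); first by move=> x [?|?]; [do 2 left|right].
  apply: entails_setU_cut LA; apply/(ddt_neg_entails ddt) => x _.
  by apply: entails_mono (triv x I) => y [?|?]; [do 2 left|right].
move=> E LE EAx; apply: companion_least => // phi.
(* Sending both p and q to [phi] turns the LEM into (phi => phi) => ((~phi => phi) => phi). *)
pose s : substitution Sg V :=
  @eval_hom Sg V (Fm Sg V)
      (fun v => if pselect (v = p \/ v = q) then phi else Var v).
have sp : s (Var p) = phi by rewrite /=; case: pselect => // -[]; left.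
have sq : s (Var q) = phi by rewrite /=; case: pselect => // -[]; right.
(* The variables p and q may occur in [bot], so the negation is built from its image under [s],
   which is inconsistent as well. *)
exists (ddt_neg D (s @` bot) phi); split=> T thT.
  move=> negT Tphi; apply: (antitheorem_theory (s := s) abot thT).
  move/(theory_entails_set _ thT)/(ddt_neg_entails ddt): negT.
  by rewrite (setUidl (_ : [set phi] `<=` T)) ?theory_entails_set// => _ ->.
move=> Lphi; have thLT := theory_extension LE thT; apply: (thLT).
(* The E-theory T contains this instance and is also an L-theory, so the DDT of L unfolds it. *)
have /(theory_entails_set _ thLT) := axiom_instances (s := s) EAx thT.
rewrite (DDT_LEM_entails ddt enumP)// sp sq => LT.
apply: (entails_setU_cut (@ddt_refl _ _ _ _ ddt T phi)).
(* The remaining premise ~phi => phi is the hypothesis [Lphi], by the DDT. *)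
apply: entails_setU_cut LT; apply/(set_imp_entails ddt enumP).
  exact: finite_ddt_neg.
rewrite image_set1 image_ddt_neg sp sq => _ ->.
by apply: entails_mono Lphi => x [?|?]; [do 2 left|right].
Qed.

Lemma companion_PCP_LEM (N : set (fm Sg 'I_1)) (C : set (fm Sg 'I_2)) (p : V) :
  finite_set N -> global_IL L N -> global_PCP L C ->
  is_axiomatic_extension L (PCP_LEM N C p) (semisimple_companion L).
Proof.
move=> finN il pcp; split; first exact: companion_extends.
  apply: companion_axioms => T s sT; have [thT _ _] := sT.
  rewrite image_PCP_LEM => x [nu Nnu Cx]; apply: thT; move: x Cx.
  apply: PCP_intro => //.
  have [Tp|/il triv] := simple_theory_dec (s (Var p)) sT.
    by left; apply: entails_refl.
  by right; apply: triv.
move=> E LE EAx; apply: companion_least => // phi.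
exists (inst1 N phi); split=> T thT.
  move=> /(theory_entails_set _ thT) /il LT Tphi.
  move: LT; rewrite setUidl => [/(theory_entails_set _ thT) TT|_ ->//].
  by apply/seteqP; split.
move=> Lphi; have thLT := theory_extension LE thT; apply: (thLT).
apply: (PCP_finite_cut pcp _ _ Lphi); first exact: finite_image.
move=> nu Nnu; apply/(theory_entails_set _ thLT) => x Cx.
(* The axioms contain no variable but p, so the constant substitution gives the instance at
   [phi]. *)
apply: (axiom_instances (s := @eval_hom _ _ (Fm Sg V) (fun=> phi)) EAx thT).
by rewrite image_PCP_LEM; exists nu.
Qed.

End Companion.

Theorem proposition4p22 (Sg : signature) (V : Type) (L : logic Sg V)
    (V_infinite : infinite_set [set: V]) (L_coatomic : coatomic L) :
  (forall (bot : set (fm Sg V)) (D : set (fm Sg 'I_2))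
          (enum : set (fm Sg V) -> seq (fm Sg V)) (p q : V),
     finite_set bot -> antitheorem L bot ->
     finite_set D -> global_DDT L D ->
     enumeration enum -> p <> q ->
     is_axiomatic_extension L (DDT_LEM enum D bot p q) (semisimple_companion L))
  /\
  (forall (N : set (fm Sg 'I_1)) (C : set (fm Sg 'I_2)) (p : V),
     finite_set N -> global_IL L N -> global_PCP L C ->
     is_axiomatic_extension L (PCP_LEM N C p) (semisimple_companion L)).
Proof.
split=> [bot D enum p q finb abot finD ddt enumP _|N C p].
  exact: companion_DDT_LEM.
exact: companion_PCP_LEM.
Qed.
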